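(* Let $\mathcal F=\{f_i(x)=r_ix+b_i\}_{i=1}^m$ be a non-degenerate affine reverse iterated function system on $\mathbb R$, with $r_i,b_i\in\mathbb R$ and $|r_i|>1$ for all $i$, and let $a\in\mathbb R$. Let $s$ be the unique solution of $\sum_{i=1}^m|r_i|^{-s}=1$. If the orbit $\mathcal O^+_{\mathcal F}(a)$ is locally finite and has finite overlaps, then there exists a constant $C_1>1$ such that $$C_1^{-1}h^s\le\#\bigl(\mathcal O^+_{\mathcal F}(a)\cap[-h,h]\bigr)\le C_1h^s$$ for all sufficiently large $h$. In particular, $d_{\mathcal F}=\dim_{\mathrm M}\mathcal O^+_{\mathcal F}(a)=s$. Furthermore, if $\mathcal O^+_{\mathcal F}(a)$ is uniformly locally finite and has finite overlaps, then there exists a constant $C_2>1$ such that $$C_2^{-1}h^s\le\sup_{x\in\mathbb R}\#\bigl(\mathcal O^+_{\mathcal F}(a)\cap[x-h,x+h]\bigr)\le C_2h^s$$ for all sufficiently large $h$. In particular, $d_{\mathcal F}=\dim_{\mathrm M}\mathcal O^+_{\mathcal F}(a)=\dim_{\mathrm{Be}}\mathcal O^+_{\mathcal F}(a)=s\le1$.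
   Context: The maps $f_1,\dots,f_m$ are distinct. $\mathcal F$ is degenerate if all the maps $f_i$ have a common fixed point, and non-degenerate otherwise. $G^*(\mathcal F)$ is the semigroup of distinct maps generated by $\mathcal F$ under composition (all nonempty finite compositions), $|g'|$ is the absolute value of the linear coefficient of the affine map $g$, and $d_{\mathcal F}=\lim_{R\to\infty}\log\#\{g\in G^*(\mathcal F):|g'|\le R\}/\log R$, a limit which always exists. The forward orbit of $a$ is $\mathcal O^+_{\mathcal F}(a)=\{g(a):g\in G^*(\mathcal F)\}$; it has finite overlaps if $f_i(\mathcal O^+_{\mathcal F}(a))\cap f_j(\mathcal O^+_{\mathcal F}(a))$ is finite whenever $i\ne j$. A set $E\subseteq\mathbb R$ is locally finite if its intersection with every bounded set is finite, and uniformly locally finite if $\sup_{x\in\mathbb R}\#(E\cap[x-R,x+R])<\infty$ for every $R>0$. The mass dimension $\dim_{\mathrm M}E$ is the common value, when they agree, of the $\liminf$ and $\limsup$ as $h\to\infty$ of $\log\#(E\cap[-h,h])/\log h$. The Beurling dimension is $\dim_{\mathrm{Be}}E=\limsup_{h\to\infty}\sup_{x\in\mathbb R}\log\#(E\cap[x-h,x+h])/\log h$. *)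

(* Defs.v *)
From HB Require Import structures.
From mathcomp Require Import all_boot all_order all_algebra.
From mathcomp Require Import all_classical all_reals all_analysis.
Import Order.TTheory GRing.Theory Num.Theory.
Import numFieldNormedType.Exports.

Set Implicit Arguments.
Unset Strict Implicit.
Unset Printing Implicit Defensive.

Local Open Scope classical_set_scope.
Local Open Scope ring_scope.

Section reverse_ifs.
Context {R : realType}.

Definition affine_map (c d : R) : R -> R := fun x => c * x + d.

Section system.
Context {I : Type}.
Variable f : I -> R -> R.

Definition degenerate := exists x, forall i, f i x = x.

(* Elements are functions, so different words giving the same map are
   counted once; the identity is not included unless it is itself a nonempty
   composition. *)
Inductive map_semigroup : set (R -> R) :=
| map_semigroup_gen i : map_semigroup (f i)
| map_semigroup_comp g h :
    map_semigroup g -> map_semigroup h -> map_semigroup (g \o h).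

Definition forward_orbit (a : R) : set R := [set g a | g in map_semigroup].

Definition finite_overlaps (a : R) :=
  forall i j, i <> j ->
    finite_set ((f i @` forward_orbit a) `&` (f j @` forward_orbit a)).

Definition slope_le (t : R) : set (R -> R) :=
  [set g | map_semigroup g /\ exists c d, g = affine_map c d /\ `|c| <= t].

(* The limit defining d_F exists and equals d. *)
Definition is_growth_dim (d : \bar R) :=
  (lne (counting (slope_le t)) / (ln t)%:E)%E @[t --> +oo%R] --> d.

End system.

Section discrete_sets.
Variable E : set R.

(* Number of points in [x - h, x + h], equal to +oo if there are infinitely
   many of them. *)
Definition num_points (x h : R) : \bar R := counting (E `&` `[x - h, x + h]).

Definition sup_num_points (h : R) : \bar R :=
  ereal_sup (range (num_points ^~ h)).

Definition locally_finite :=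
  forall B : set R, bounded_set B -> finite_set (E `&` B).

Definition uniformly_locally_finite :=
  forall h : R, 0 < h -> (sup_num_points h < +oo)%E.

Definition lower_mass_dim : \bar R :=
  limf_einf (fun h : R => lne (num_points 0 h) / (ln h)%:E)%E +oo%R.

Definition upper_mass_dim : \bar R :=
  limf_esup (fun h : R => lne (num_points 0 h) / (ln h)%:E)%E +oo%R.

Definition is_mass_dim (d : \bar R) :=
  lower_mass_dim = d /\ upper_mass_dim = d.

Definition beurling_dim : \bar R :=
  limf_esup (fun h : R =>
    ereal_sup (range (fun x => lne (num_points x h) / (ln h)%:E)%E)) +oo%R.

End discrete_sets.

End reverse_ifs.

(* Main.v *)
Require Import Defs.
From mathcomp Require Import all_boot all_order all_algebra.
From mathcomp Require Import finmap.
From mathcomp Require Import all_classical all_reals all_analysis.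
From mathcomp Require Import ring lra.
Import Order.TTheory GRing.Theory Num.Theory.
Import numFieldNormedType.Exports.
Local Open Scope classical_set_scope.
Local Open Scope ring_scope.
Set Implicit Arguments.
Unset Strict Implicit.
Unset Printing Implicit Defensive.

(** The orbit is made of scaled copies of itself:
    [E = {f_i(a)} `|` \bigcup_i f_i(E)], and the part of [f_i(E)] in an interval
    of radius [h] is a copy of the part of [E] in an interval of radius
    [h / |r_i|] (lemma [counting_piece]). Counting points therefore gives
      [N(x, h) <= \sum_i N((x - b_i) / r_i, h / |r_i|) + m],
    and, when the copies have finite overlaps, the reverse inequality with
    another additive constant (lemmas [num_points_rec_le] and
    [num_points_rec_ge]).

    The centres are removed as follows. For the intervals centred at [0],
    replacing [N(0, h)] by [N(0, h + d)] for the upper bound and by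
    [N(0, h - d)] for the lower bound, with [|b_i| + d <= d |r_i|] for all [i],
    absorbs the translations [b_i]. The supremum over all centres satisfies the
    upper recursion directly. In each case the counting function [M] satisfies,
    up to a constant [K], [M h <= \sum_i M (h / |r_i|)] or the reverse
    inequality. As
    [\sum_i |r_i|^-s = 1], the function [h^s] solves the equation exactly, and
    since [m >= 2] the functions [C h^s - K] and [c h^s + K] are a super- and a
    subsolution. Induction on scales then gives [M h <= C h^s]
    (lemma [recursion_upper]) and [c h^s <= M h] (lemma [recursion_lower]). The
    latter needs [M] to exceed [K] somewhere, which holds when [E] is infinite.
    It is: a finite orbit is mapped into itself by expanding maps, hence is a
    single common fixed point, which non-degeneracy excludes.

    The semigroup satisfies the same recursion: the elements of slope at most
    [t] are the [f_i] and the [f_i \o g] with [g] of slope at most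
    [t / |r_i|], and the branches [f_i \o G] are pairwise disjoint, because
    [f_i \o g = f_j \o h] would put the infinite set [f_i (g E)] in
    [f_i(E) `&` f_j(E)]. So its growth is also of order [t^s].

    Finally, cutting an interval in two halves shows that
    [M(h) = \sup_x N(x, h)] satisfies [M h <= M (h / 2) + M (h / 2)]. This is
    the same recursion with ratios [2, 2] and exponent [1], so [M h <= C h], and
    comparing with [c h^s <= M h] gives [s <= 1]. *)

(** * Counting *)

Section counting.
Context {R : realType}.
Local Open Scope ereal_scope.

Lemma counting_fset (T : choiceType) (A : set T) : finite_set A ->
  counting A = (#|` fset_set A |)%:R%:E :> \bar R.
Proof. by move=> fA; rewrite /counting asboolT. Qed.

Lemma counting_infinite (T : choiceType) (A : set T) : ~ finite_set A ->
  counting A = +oo :> \bar R.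
Proof. by move=> fA; rewrite /counting asboolF. Qed.

Lemma counting_nneg (T : choiceType) (A : set T) : 0 <= counting A :> \bar R.
Proof.
have [fA|/counting_infinite -> //] := pselect (finite_set A).
by rewrite counting_fset// lee_fin.
Qed.

Lemma le_counting (T : choiceType) (A B : set T) : A `<=` B ->
  counting A <= counting B :> \bar R.
Proof.
move=> AB; have [fB|/counting_infinite ->] := pselect (finite_set B);
  last exact: leey.
have fA := sub_finite_set AB fB.
rewrite !counting_fset// lee_fin ler_nat fsubset_leq_card//.
by rewrite -fset_set_sub.
Qed.

Lemma countingU_le (T : choiceType) (A B : set T) :
  counting (A `|` B) <= counting A + counting B :> \bar R.
Proof.
have [fA|/counting_infinite ->] := pselect (finite_set A); last first.
  by rewrite addye ?leey// gt_eqF// (lt_le_trans _ (counting_nneg _))// ltNyr.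
have [fB|/counting_infinite ->] := pselect (finite_set B); last first.
  by rewrite addey ?leey// gt_eqF// (lt_le_trans _ (counting_nneg _))// ltNyr.
have fU : finite_set (A `|` B) by rewrite finite_setU.
rewrite !counting_fset// -EFinD lee_fin -natrD ler_nat fset_setU//.
by rewrite cardfsU leq_subr.
Qed.

Lemma countingU (T : choiceType) (A B : set T) : A `&` B = set0 ->
  counting (A `|` B) = counting A + counting B :> \bar R.
Proof.
move=> AB0.
have Noo (C : set T) : counting C != -oo :> \bar R.
  by rewrite gt_eqF// (lt_le_trans _ (counting_nneg _))// ltNyr.
have [fA|iA] := pselect (finite_set A); last first.
  rewrite (counting_infinite iA) addye// counting_infinite//.
  by rewrite finite_setU => -[].
have [fB|iB] := pselect (finite_set B); last first.
  rewrite (counting_infinite iB) addey// counting_infinite//.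
  by rewrite finite_setU => -[].
have fU : finite_set (A `|` B) by rewrite finite_setU.
rewrite !counting_fset// -EFinD -natrD fset_setU// cardfsU -fset_setI// AB0.
by rewrite fset_set0 cardfs0 subn0.
Qed.

Lemma counting_image (T U : choiceType) (f : T -> U) (A : set T) :
  injective f -> counting (f @` A) = counting A :> \bar R.
Proof.
move=> fI; have [fA|iA] := pselect (finite_set A).
  have fIm : finite_set (f @` A) by exact: finite_image.
  by rewrite !counting_fset// fset_set_image// card_imfset.
rewrite !counting_infinite//; apply: contra_not iA.
by rewrite -(eq_finite_set (inj_card_eq (in2W fI : {in A &, injective f}))).
Qed.

(** A set covered by [m] pieces [F i] and [m] points [p i] has at most
    [\sum_i #(F i) + m] elements. *)
Lemma counting_cover_le (T : choiceType) (m : nat) (F : 'I_m -> set T)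
    (p : 'I_m -> T) (A : set T) :
  (forall x, A x -> exists i, x = p i \/ F i x) ->
  counting A <= \sum_(i < m) counting (F i) + m%:R%:E :> \bar R.
Proof.
move=> AF; have -> : m%:R%:E = \sum_(i < m) 1%:E :> \bar R.
  by rewrite sumEFin sumr_const card_ord.
rewrite -big_split /=.
apply: (@le_trans _ _ (counting (\big[setU/set0]_(i < m) (F i `|` [set p i])))).
  apply: le_counting => x /AF[i Fix]; rewrite (bigD1 i)//=.
  by left; case: Fix => [->|]; [right|left].
elim/big_rec2 : _ => [|i A' x _ xA]; first by rewrite counting_fset// fset_set0.
apply: le_trans (countingU_le _ _) _; apply: leeD => //.
apply: le_trans (countingU_le _ _) _.
by rewrite (counting_fset (finite_set1 (p i))) fset_set1 cardfs1.
Qed.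

Lemma sum_counting_le (T : choiceType) (m : nat) (F : 'I_m -> set T)
    (A : set T) :
  (forall i, F i `<=` A) -> (forall i j, i != j -> F i `&` F j = set0) ->
  \sum_(i < m) counting (F i) <= counting A :> \bar R.
Proof.
elim: m F A => [|m IH] F A FA tF; first by rewrite big_ord0 counting_nneg.
rewrite big_ord_recl -(setDUK (FA ord0)) countingU ?setDIK// leeD2l//.
apply: IH => [i x Fx|i j ij]; last by apply: tF; rewrite (inj_eq lift_inj).
split; first exact: FA Fx.
by move=> F0x; have : (F ord0 `&` F (lift ord0 i)) x by []; rewrite tF.
Qed.

(** If the pieces [F i] overlap only inside [Z], their cardinals add up to at
    most that of the whole, up to [m * #Z]. *)
Lemma sum_counting_overlap_le (T : choiceType) (m : nat) (F : 'I_m -> set T)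
    (A Z : set T) :
  (forall i, F i `<=` A) -> (forall i j, i != j -> F i `&` F j `<=` Z) ->
  \sum_(i < m) counting (F i) <=
    counting A + \sum_(i < m) counting Z :> \bar R.
Proof.
move=> FA FZ.
apply: (@le_trans _ _ (\sum_(i < m) (counting (F i `\` Z) + counting Z))).
  apply: lee_sum => i _; rewrite -{1}(setUIDK (F i) Z) setUC.
  apply: le_trans (countingU_le _ _) _.
  by rewrite leeD2l ?le_counting ?subIsetr.
rewrite big_split leeD2r//=; apply: sum_counting_le => [i x [Fx _]|i j ij].
  exact: FA Fx.
by apply/seteqP; split => // x [[Fi nZ] [Fj _]]; apply: nZ; apply: FZ ij _ _.
Qed.
End counting.

(** * The scaling recursion *)

Section scaling.
Context {R : realType}.

Lemma unbounded_expr (q x : R) : 1 < q -> exists n, x <= q ^+ n.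
Proof.
move=> q1; have bern n : 1 + n%:R * (q - 1) <= q ^+ n.
  elim: n => [|n IH]; first by rewrite mul0r addr0 expr0.
  apply: le_trans (_ : q * (1 + n%:R * (q - 1)) <= _); last first.
    by rewrite exprS ler_wpM2l// ltW// (lt_trans ltr01).
  have : 0 <= n%:R * (q - 1) ^+ 2 by rewrite mulr_ge0 ?sqr_ge0.
  by rewrite -natr1; nra.
exists (Num.bound (`|x| / (q - 1))); apply: le_trans (bern _).
have y0 : 0 <= `|x| / (q - 1) by rewrite divr_ge0// subr_ge0 ltW.
have := ltW (archi_boundP y0); rewrite ler_pdivrMr ?subr_gt0// => H.
by rewrite (le_trans (ler_norm _))// (le_trans H)// lerDr.
Qed.

Variables (m : nat) (rho : 'I_m -> R) (s : R).
Hypotheses (rho_gt1 : forall i, 1 < rho i) (m_gt1 : (1 < m)%N).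
Hypothesis (sum_rho : \sum_(i < m) rho i `^ (- s) = 1).

Lemma ratio_gt0 i : 0 < rho i.
Proof. by rewrite (lt_trans ltr01). Qed.

Lemma similarity_dim_gt0 : 0 < s.
Proof.
rewrite ltNge; apply/negP => s0.
have : \sum_(i < m) (1 : R) <= 1.
  rewrite -[leRHS]sum_rho; apply: ler_sum => i _.
  by rewrite -(powRr0 (rho i)) ler_powR ?oppr_ge0// ltW.
by rewrite sumr_const card_ord (ler_nat _ _ 1) leqNgt m_gt1.
Qed.

(** The function [h `^ s] solves the scaling recursion exactly. *)
Lemma sum_powR_div (h : R) : 0 <= h -> \sum_(i < m) (h / rho i) `^ s = h `^ s.
Proof.
move=> h0; rewrite -[RHS]mulr1 -sum_rho mulr_sumr; apply: eq_bigr => i _.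
have r0 := ltW (ratio_gt0 i).
rewrite powRM ?invr_ge0//; congr (_ * _).
by rewrite -powR_inv1// -powRrM mulN1r.
Qed.

Lemma ratio_bounds : exists q L, [/\ 1 < q, 0 < L & forall i, q <= rho i <= L].
Proof.
exists (\big[Num.min/2]_(i < m) rho i), (\sum_(i < m) rho i).
have i0 : 'I_m := Ordinal m_gt1.
have le_sum i : rho i <= \sum_(i < m) rho i.
  by rewrite (bigD1 i)//= lerDl sumr_ge0// => j _; exact/ltW/ratio_gt0.
split; first by apply: lt_bigmin => //; rewrite ltr1n.
  exact: lt_le_trans (ratio_gt0 i0) (le_sum i0).
by move=> i; rewrite bigmin_le le_sum.
Qed.

(** Induction on scales: a property that holds for [u <= h <= u * L], where [L]
    bounds all the ratios, and passes from all the [h / rho i] to [h], holds for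
    all [h >= u]. *)
Lemma scale_ind (u L : R) (P : R -> Prop) : 0 < u ->
  (forall i, rho i <= L) ->
  (forall h, u <= h -> h <= u * L -> P h) ->
  (forall h, u * L < h -> (forall i, P (h / rho i)) -> P h) ->
  forall h, u <= h -> P h.
Proof.
move=> u0 rhoL P0 PS h uh; have [q [L' [q1 _ qrho]]] := ratio_bounds.
have i0 : 'I_m := Ordinal m_gt1.
have L0 : 0 < L by apply: lt_le_trans (ratio_gt0 i0) (rhoL i0).
have uL0 : 0 < u * L by rewrite mulr_gt0.
(* Each step extends the range by the factor [q > 1], a lower bound of the
   ratios. *)
suff H n : forall h, u <= h -> h <= u * L * q ^+ n -> P h.
  have [n hn] := unbounded_expr (h / (u * L)) q1.
  by apply: (H n) => //; rewrite mulrC -ler_pdivrMr.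
elim: n => {h uh} [|n IH] h uh; first by rewrite expr0 mulr1; exact: P0.
move=> hn; have [|uLh] := leP h (u * L); first exact: P0.
apply: PS => // i; apply: IH.
  rewrite ler_pdivlMr ?ratio_gt0// (le_trans _ (ltW uLh))//.
  by rewrite ler_wpM2l// ltW.
rewrite ler_pdivrMr ?ratio_gt0// (le_trans hn)// exprSr mulrA.
have /andP[qr _] := qrho i.
by rewrite ler_wpM2l// mulr_ge0 ?(ltW uL0)// exprn_ge0// ltW// (lt_trans ltr01).
Qed.

(** A nondecreasing subsolution of the scaling recursion, up to an additive
    constant, is at most of order [h `^ s]. *)
Lemma recursion_upper (M : R -> \bar R) (K : R) : 0 <= K ->
  {homo M : x y / x <= y >-> (x <= y)%E} -> (M 1%R < +oo)%E ->
  (forall h, 1 <= h -> (M h <= \sum_(i < m) M (h / rho i)%R + K%:E)%E) ->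
  exists2 C, 0 < C & forall h, 1 <= h -> (M h <= (C * h `^ s)%:E)%E.
Proof.
move=> K0 Mh M1 Mrec; have s0 := similarity_dim_gt0.
have [q [L [q1 L0 qL]]] := ratio_bounds.
have [B B0 MB] : exists2 B, 0 <= B & (M 1%R <= B%:E)%E.
  case: (M 1) M1 => [x _|//|_]; last by exists 0; rewrite ?leNye.
  by exists `|x| => //; rewrite lee_fin ler_norm.
have i0 : 'I_m := Ordinal m_gt1.
have L1 : 1 < L by have /andP[_] := qL i0; exact: lt_le_trans.
(* The bound [C * h `^ s - K] is stable under the recursion, because there are
   at least two pieces: [- m * K + K <= - K]. The constant [C] makes it hold
   initially, for [L^-1 <= h <= 1], where [M h <= M 1 <= B]. *)
pose C := (B + K + 1) * L `^ s.
have C0 : 0 < C by rewrite mulr_gt0 ?powR_gt0// ltr_wpDl// addr_ge0.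
suff H h : L^-1 <= h -> (M h <= (C * h `^ s - K)%:E)%E.
  exists C => // h h1; apply: le_trans (H h _) _.
    by rewrite (le_trans _ h1)// invf_le1// ltW.
  by rewrite lee_fin gerBl.
apply: (@scale_ind L^-1 L (fun h => M h <= (C * h `^ s - K)%:E)%E).
- by rewrite invr_gt0.
- by move=> i; have /andP[] := qL i.
- move=> {}h Lh; rewrite mulVf ?gt_eqF// => h1.
  apply: le_trans (Mh _ _ h1) _; apply: le_trans MB _; rewrite lee_fin.
  rewrite lerBrDr /C -mulrA -powRM ?(ltW L0)//; last first.
    by rewrite (le_trans _ Lh)// invr_ge0 ltW.
  have : 1 <= (L * h) `^ s.
    rewrite -(powRr0 (L * h)) ler_powR ?(ltW s0)//.
    by rewrite mulrC -ler_pdivrMr// div1r.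
  by move: B0 K0; set t := _ `^ _; nra.
move=> {}h; rewrite mulVf ?gt_eqF// => h1 IH.
apply: le_trans (Mrec h (ltW h1)) _.
apply: (@le_trans _ _
  (\sum_(i < m) (C * (h / rho i) `^ s - K)%:E + K%:E)%E).
  by rewrite leeD2r// lee_sum.
rewrite sumEFin -EFinD lee_fin sumrB -mulr_sumr sum_powR_div; last first.
  by rewrite (le_trans _ (ltW h1)).
rewrite sumr_const card_ord -addrA lerD2l.
have : K *+ 2 <= K *+ m.
  have m2 : (2%:R : R) <= m%:R by rewrite ler_nat.
  by rewrite -(mulr_natr K 2) -(mulr_natr K m) ler_wpM2l.
by rewrite mulr2n; lra.
Qed.

(** A nondecreasing supersolution, up to an additive constant [K], is at least
    of order [h `^ s] once it takes a value at least [K + 1]. *)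
Lemma recursion_lower (M : R -> \bar R) (K u : R) : 0 <= K -> 0 < u ->
  {homo M : x y / x <= y >-> (x <= y)%E} -> ((K + 1)%:E <= M u)%E ->
  (forall h, u <= h -> (\sum_(i < m) M (h / rho i)%R <= M h + K%:E)%E) ->
  exists2 c, 0 < c & forall h, u <= h -> ((c * h `^ s)%:E <= M h)%E.
Proof.
move=> K0 u0 Mh MB Mrec; have s0 := similarity_dim_gt0.
have [q [L [q1 L0 qL]]] := ratio_bounds.
have i0 : 'I_m := Ordinal m_gt1.
have L1 : 1 < L by have /andP[_] := qL i0; exact: lt_le_trans.
have uL0 : 0 < u * L by rewrite mulr_gt0.
(* Dually, [c * h `^ s + K] is stable under the recursion; [c * h `^ s <= 1]
   initially, for [u <= h <= u * L]. *)
pose c := ((u * L) `^ s)^-1.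
have c0 : 0 < c by rewrite invr_gt0 powR_gt0.
suff H h : u <= h -> ((c * h `^ s + K)%:E <= M h)%E.
  by exists c => // h uh; apply: le_trans (H h uh); rewrite lee_fin lerDl.
apply: (@scale_ind u L (fun h => (c * h `^ s + K)%:E <= M h)%E) => //.
- by move=> i; have /andP[] := qL i.
- move=> {}h uh huL.
  apply: le_trans (Mh _ _ uh); apply: le_trans MB; rewrite lee_fin addrC lerD2l.
  rewrite mulrC ler_pdivrMr ?powR_gt0// mul1r ge0_ler_powR// ?nnegrE ?ltW//.
  exact: lt_le_trans uh.
move=> {}h h1 IH; have uh : u <= h.
  by rewrite (le_trans _ (ltW h1))// ler_peMr// ltW.
rewrite -(leeD2rE _ _ (_ : K%:E \is a fin_num))//; apply: le_trans (Mrec h uh).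
apply: (@le_trans _ _
  (\sum_(i < m) (c * (h / rho i) `^ s + K)%:E)%E); last first.
  by rewrite lee_sum.
rewrite sumEFin -EFinD lee_fin big_split /= -mulr_sumr sum_powR_div; last first.
  by rewrite (le_trans (ltW u0)).
rewrite sumr_const card_ord -addrA lerD2l.
have : K *+ 2 <= K *+ m.
  have m2 : (2%:R : R) <= m%:R by rewrite ler_nat.
  by rewrite -(mulr_natr K 2) -(mulr_natr K m) ler_wpM2l.
by rewrite mulr2n.
Qed.

End scaling.

(** * Logarithmic ratios and dimensions *)

Section log_ratio.
Context {R : realType}.

Lemma cvg_lny : ln h @[h --> +oo%R] --> (+oo%R : set_system R).
Proof.
apply/cvgryPge => A; near=> h.
have Ah : expR A <= h by near: h; exact: nbhs_pinfty_ge.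
by rewrite -(expRK A) ler_ln ?posrE ?expR_gt0// (lt_le_trans (expR_gt0 A)).
Unshelve. all: by end_near. Qed.

Lemma log_ratio_powR (c s : R) : 0 < c ->
  (lne (c * h `^ s)%:E / (ln h)%:E)%E @[h --> +oo%R] --> s%:E.
Proof.
move=> c0; apply: (@cvg_trans _ ((ln c * (ln h)^-1 + s)%:E @[h --> +oo%R])).
  apply: near_eq_cvg; near=> h.
  have h1 : 1 < h by near: h; exact: nbhs_pinfty_gt.
  have l0 : 0 < ln h by rewrite ln_gt0.
  have h0 : 0 < h by rewrite (lt_trans ltr01).
  rewrite lne_EFin ?mulr_gt0 ?powR_gt0// lnM ?posrE ?powR_gt0// ln_powR.
  by rewrite inver gt_eqF// -EFinM mulrDl mulfK// gt_eqF.
apply: cvg_EFin; first by near=> h.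
rewrite [X in _ --> X](_ : s = ln c * 0 + s); last by rewrite mulr0 add0r.
apply: cvgD; last exact: cvg_cst.
apply: cvgM; first exact: cvg_cst.
apply/gtr0_cvgV0; last exact: cvg_lny.
near=> h; rewrite ln_gt0//; near: h; exact: nbhs_pinfty_gt.
Unshelve. all: by end_near. Qed.

Lemma le_log_ratio (x y : \bar R) (h : R) : 1 < h -> (0 <= x)%E -> (x <= y)%E ->
  (lne x / (ln h)%:E <= lne y / (ln h)%:E)%E.
Proof.
move=> h1 x0 xy; apply: lee_wpmul2r.
  by rewrite inver gt_eqF ?ln_gt0// lee_fin invr_ge0 ltW// ln_gt0.
by rewrite lee_lne// in_itv /= leey ?andbT// (le_trans x0).
Qed.

Lemma log_ratio_cvg (N : R -> \bar R) (c C s : R) : 0 < c -> 0 < C ->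
  (\forall h \near +oo%R, ((c * h `^ s)%:E <= N h <= (C * h `^ s)%:E)%E) ->
  (lne (N h) / (ln h)%:E)%E @[h --> +oo%R] --> s%:E.
Proof.
move=> c0 C0 NcC.
apply: squeeze_cvge; [|exact: log_ratio_powR c0|exact: log_ratio_powR C0].
near=> h.
have h1 : 1 < h by near: h; exact: nbhs_pinfty_gt.
have /andP[cN NC] : ((c * h `^ s)%:E <= N h <= (C * h `^ s)%:E)%E by near: h.
have p0 : (0 <= (c * h `^ s)%:E)%E by rewrite lee_fin mulr_ge0 ?powR_ge0// ltW.
by rewrite !le_log_ratio// (le_trans p0).
Unshelve. all: by end_near. Qed.

Lemma cvg_limf_esup (T : choiceType) (X : filteredType T) (F : set_system X)
    (f : X -> \bar R) (l : R) : ProperFilter F ->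
  f x @[x --> F] --> l%:E -> limf_esup f F = l%:E.
Proof.
move=> FF fl; rewrite limf_esupE; apply/le_anti/andP; split.
- apply/lee_addgt0Pr => e e0.
  have Fe : F [set x | (f x <= l%:E + e%:E)%E].
    have : nbhs l%:E [set y : \bar R | (y < l%:E + e%:E)%E].
      apply: open_nbhs_nbhs; split; first exact: open_ereal_lt_ereal.
      by rewrite /= lte_fin ltrDl.
    by move=> /fl; rewrite nbhs_filterE/=; apply: (@filterS _ F) => x /ltW.
  apply: (@le_trans _ _
    (ereal_sup (f @` [set x | (f x <= l%:E + e%:E)%E]))%E).
    by apply: ereal_inf_lbound; exists [set x | (f x <= l%:E + e%:E)%E].
  by apply: ge_ereal_sup => _ [x ? <-].
- apply: le_ereal_inf_tmp => _ [V FV <-].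
  apply: (cvge_to_le fl); apply: filterS FV => x Vx.
  by apply: ereal_sup_ubound; exists x.
Qed.

Lemma cvg_limf_einf (T : choiceType) (X : filteredType T) (F : set_system X)
    (f : X -> \bar R) (l : R) : ProperFilter F ->
  f x @[x --> F] --> l%:E -> limf_einf f F = l%:E.
Proof.
move=> FF /cvgeN fl; rewrite /limf_einf -[RHS]oppeK; congr (- _)%E.
by rewrite (cvg_limf_esup (l := - l)).
Qed.

Lemma mass_dim_eq (E : set R) (c C s : R) : 0 < c -> 0 < C ->
  (\forall h \near +oo%R,
    ((c * h `^ s)%:E <= num_points E 0 h <= (C * h `^ s)%:E)%E) ->
  is_mass_dim E s%:E.
Proof.
move=> c0 C0 /(log_ratio_cvg c0 C0) H.
by split; [exact: cvg_limf_einf|exact: cvg_limf_esup].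
Qed.

Lemma beurling_dim_eq (E : set R) (c C s : R) : 0 < c -> 0 < C ->
  (\forall h \near +oo%R, ((c * h `^ s)%:E <= num_points E 0 h)%E) ->
  (\forall h \near +oo%R, (sup_num_points E h <= (C * h `^ s)%:E)%E) ->
  beurling_dim E = s%:E.
Proof.
move=> c0 C0 Ec EC; apply: cvg_limf_esup.
apply: squeeze_cvge; [|exact: log_ratio_powR c0|exact: log_ratio_powR C0].
near=> h.
have h1 : 1 < h by near: h; exact: nbhs_pinfty_gt.
apply/andP; split.
  apply: le_trans (ereal_sup_ubound _) ; last by exists 0.
  apply: le_log_ratio => //; first by rewrite lee_fin mulr_ge0 ?powR_ge0// ltW.
  by near: h.
apply: ge_ereal_sup => _ [x _ <-]; apply: le_log_ratio => //.
apply: (@le_trans _ _ (sup_num_points E h)); last by near: h.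
by apply: ereal_sup_ubound; exists x.
Unshelve. all: by end_near. Qed.

(** A function squeezed between multiples of [h `^ s] and [h `^ t] forces
    [s <= t]. *)
Lemma le_exponent (M : R -> \bar R) (c C s t : R) : 0 < c -> 0 < C ->
  (\forall h \near +oo%R, ((c * h `^ s)%:E <= M h)%E) ->
  (\forall h \near +oo%R, (M h <= (C * h `^ t)%:E)%E) -> s <= t.
Proof.
move=> c0 C0 Mc MC; rewrite -lee_fin.
have cs := @log_ratio_powR c s c0; have Ct := @log_ratio_powR C t C0.
rewrite -(cvg_lim _ cs)// -(cvg_lim _ Ct)//; apply: lee_lim.
- by apply/cvg_ex; exists s%:E.
- by apply/cvg_ex; exists t%:E.
near=> h; have h1 : 1 < h by near: h; exact: nbhs_pinfty_gt.
apply: le_log_ratio => //; first by rewrite lee_fin mulr_ge0 ?powR_ge0// ltW.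
by apply: (@le_trans _ _ (M h)); near: h.
Unshelve. all: by end_near. Qed.

(** Two one-sided bounds merge into a single constant. *)
Lemma common_constant (M : R -> \bar R) (c C s : R) : 0 < c -> 0 < C ->
  (\forall h \near +oo%R, ((c * h `^ s)%:E <= M h)%E) ->
  (\forall h \near +oo%R, (M h <= (C * h `^ s)%:E)%E) ->
  exists C1 : R, 1 < C1 /\ \forall h \near +oo%R,
    ((C1^-1 * h `^ s)%:E <= M h /\ M h <= (C1 * h `^ s)%:E)%E.
Proof.
move=> c0 C0 Mc MC; have ci0 : 0 < c^-1 by rewrite invr_gt0.
exists (1 + C + c^-1); have D0 : 0 < 1 + C + c^-1 by rewrite !addr_gt0.
split; first by rewrite -addrA ltrDl addr_gt0.
near=> h; split.
  apply: (@le_trans _ _ (c * h `^ s)%:E); last by near: h.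
  rewrite lee_fin ler_wpM2r ?powR_ge0// invf_ple ?posrE//.
  by rewrite lerDr addr_ge0// ltW.
apply: (@le_trans _ _ (C * h `^ s)%:E); first by near: h.
by rewrite lee_fin ler_wpM2r ?powR_ge0//; lra.
Unshelve. all: by end_near. Qed.

End log_ratio.

(** * Point counts of sets of reals *)

Section point_counts.
Context {R : realType}.

Lemma le_num_points (E : set R) (x h x' h' : R) : `|x - x'| + h <= h' ->
  (num_points E x h <= num_points E x' h')%E.
Proof.
move=> hh; apply: le_counting => z [Ez]; rewrite /= !in_itv /= => /andP[z1 z2].
have := ler_norm (x - x'); have := ler_norm (x' - x); rewrite distrC => n1 n2.
by split=> //; apply/andP; split; lra.
Qed.

Lemma locally_finite_num_points (E : set R) (x h : R) : locally_finite E ->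
  (num_points E x h < +oo)%E.
Proof.
move=> lE; rewrite /num_points counting_fset ?ltry//; apply: lE.
exists (`|x| + `|h|); split; first exact: num_real.
move=> M ltM z; rewrite /= in_itv /= => /andP[z1 z2].
apply: le_trans (ltW ltM); have := ler_norm x; have := ler_norm h.
have := ler_norm (- x); have := ler_norm (- h); rewrite !normrN => ? ? ? ?.
by rewrite ler_norml; apply/andP; split; lra.
Qed.

Lemma uniformly_locally_finiteW (E : set R) :
  uniformly_locally_finite E -> locally_finite E.
Proof.
move=> uE B [M [_ MB]]; have M0 : 0 < `|M| + 1 by rewrite ltr_wpDl.
have EB : E `&` B `<=` E `&` `[0 - (`|M| + 1), 0 + (`|M| + 1)].
  move=> z [Ez Bz]; split => //; rewrite /= in_itv /= sub0r add0r -ler_norml.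
  by apply: MB => //; rewrite (le_lt_trans (ler_norm M))// ltrDl.
apply: sub_finite_set EB _; apply: contrapT => /(@counting_infinite R) H.
have := uE _ M0; rewrite ltNge => /negP; apply.
by rewrite -H; apply: ereal_sup_ubound; exists 0.
Qed.

Lemma infinite_num_points (E : set R) (K : R) : infinite_set E ->
  exists2 h, 0 < h & (K%:E <= num_points E 0 h)%E.
Proof.
move=> iE; have [X XE Xn] := infinite_set_fset (Num.bound `|K|) iE.
pose B := \sum_(x <- X) `|x| + 1.
have s0 (s : seq R) : 0 <= \sum_(x <- s) `|x| by rewrite sumr_ge0.
exists B; first by rewrite ltr_wpDl.
have XB : [set` X] `<=` E `&` `[0 - B, 0 + B].
  move=> x Xx; split; first exact: XE.
  rewrite /= in_itv /= sub0r add0r -ler_norml /B (big_rem x)//=.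
  by rewrite -addrA lerDl addr_ge0.
apply: le_trans (le_counting XB).
rewrite counting_fset// set_fsetK lee_fin (le_trans (ler_norm K))//.
by rewrite (le_trans (ltW (archi_boundP (normr_ge0 K))))// ler_nat.
Qed.

Lemma homo_sup_num_points (E : set R) :
  {homo sup_num_points E : x y / x <= y >-> (x <= y)%E}.
Proof.
move=> x y xy; apply: ge_ereal_sup => _ [z _ <-].
apply: (@le_trans _ _ (num_points E z y)).
  by apply: le_num_points; rewrite subrr normr0 add0r.
by apply: ereal_sup_ubound; exists z.
Qed.

(** Subadditivity under halving of intervals: the scaling recursion with ratios
    [2, 2], whose exponent is [1]. *)
Lemma sup_num_points_linear (E : set R) :
  uniformly_locally_finite E -> exists2 C, 0 < C &
  forall h, 1 <= h -> (sup_num_points E h <= (C * h `^ 1)%:E)%E.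
Proof.
move=> uE; apply: (@recursion_upper _ 2 (fun=> 2) 1 _ _ _ _ 0) => //.
- by move=> _; rewrite ltr1n.
- by rewrite !big_ord_recl big_ord0 powR_inv1//; lra.
- exact: homo_sup_num_points.
- exact: uE.
move=> h h1; rewrite adde0 !big_ord_recl big_ord0 adde0.
apply: ge_ereal_sup => _ [x _ <-].
apply: (@le_trans _ _ (num_points E (x - h / 2) (h / 2) +
                       num_points E (x + h / 2) (h / 2)))%E.
  apply: le_trans (countingU_le _ _); apply: le_counting => z [Ez] /=.
  rewrite !in_itv /= => /andP[z1 z2]; have [zx|xz] := leP z x; [left|right];
  by split => //=; apply/andP; split; lra.
apply: leeD; apply: ereal_sup_ubound; first by exists (x - h / 2).
by exists (x + h / 2).
Qed.

End point_counts.

(** * Orbits of expanding affine systems *)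

Section affine_system.
Context {R : realType}.

Lemma affine_map_inj (c d : R) : c != 0 -> injective (affine_map c d).
Proof. by move=> c0 x y /addIr /(mulfI c0). Qed.

Lemma affine_map_eq (c d c' d' : R) :
  affine_map c d = affine_map c' d' -> c = c'.
Proof.
move=> e; have := congr1 (fun g => g 1 - g 0) e.
by rewrite /affine_map !mulr1 !mulr0 !add0r !addrK.
Qed.

Lemma affine_map_comp (c d c' d' : R) :
  affine_map c d \o affine_map c' d' = affine_map (c * c') (c * d' + d).
Proof. by apply/funext => x; rewrite /affine_map /= mulrDr mulrA addrA. Qed.

(** Elements of the semigroup, decomposed along their outermost generator. *)
Lemma map_semigroup_cases (I : Type) (f : I -> R -> R) g : map_semigroup f g ->
  exists i, g = f i \/ exists2 h, map_semigroup f h & g = f i \o h.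
Proof.
elim=> [i|{}g h _ IHg Hh _]; first by exists i; left.
have [i [->|[g' Hg' ->]]] := IHg; exists i; right; first by exists h.
by exists (g' \o h) => //; exact: map_semigroup_comp.
Qed.

Variables (m : nat) (r b : 'I_m -> R) (a : R).
Hypothesis r_gt1 : forall i, 1 < `|r i|.

Let f := fun i => affine_map (r i) (b i).
Let E := forward_orbit f a.

Lemma slope_gt0 i : 0 < `|r i|.
Proof. by rewrite (lt_trans ltr01). Qed.

Lemma slope_neq0 i : r i != 0.
Proof. by rewrite -normr_gt0 slope_gt0. Qed.

Lemma forward_orbit_gen i : E (f i a).
Proof. by exists (f i) => //; exact: map_semigroup_gen. Qed.

Lemma forward_orbit_stable i x : E x -> E (f i x).
Proof.
move=> [g Gg <-]; exists (f i \o g) => //.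
by apply: map_semigroup_comp => //; exact: map_semigroup_gen.
Qed.

Lemma forward_orbit_cases x : E x ->
  exists i, x = f i a \/ exists2 y, E y & x = f i y.
Proof.
move=> [g Gg <-]; have [i [->|[h Gh ->]]] := map_semigroup_cases Gg.
  by exists i; left.
by exists i; right; exists (h a) => //; exists h.
Qed.

Lemma nondegenerate_gt1 : ~ degenerate f -> (1 < m)%N.
Proof.
move=> nd; rewrite ltnNge; apply/negP => m1; apply: nd.
case: (pickP 'I_m) => [i0 _|m0]; last by exists 0 => i; have := m0 i.
have ri : 1 - r i0 != 0.
  rewrite subr_eq0; apply/eqP => r1; have := r_gt1 i0.
  by rewrite -r1 normr1 ltxx.
exists (b i0 / (1 - r i0)) => i; have -> : i = i0.
  have k0 (k : 'I_m) : k = 0%N :> nat.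
    by apply/eqP; rewrite -leqn0 -ltnS (leq_trans (ltn_ord k)).
  by apply: val_inj; rewrite /= !k0.
by rewrite /f /affine_map; field.
Qed.

(** A finite orbit has finite diameter; the maps send the orbit into itself and
    expand distances, so the orbit is one point, fixed by all maps. *)
Lemma nondegenerate_orbit_infinite : ~ degenerate f -> infinite_set E.
Proof.
move=> nd fE; have m1 := nondegenerate_gt1 nd; apply: nd.
have i0 : 'I_m := Ordinal m1.
have [B EB] : exists B, forall x, E x -> `|x| <= B.
  have [X XE] := finite_fsetP.1 fE; exists (\sum_(x <- X) `|x|) => x.
  by rewrite XE /= => xX; rewrite (big_rem x)//= lerDl sumr_ge0.
have E1 x y : E x -> E y -> x = y.
  move=> Ex Ey; apply/eqP; rewrite -subr_eq0; apply/negPn/negP => xy.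
  (* Iterating one map multiplies distances by [|r i0| ^ n]. *)
  have H n u v : E u -> E v -> `|r i0| ^+ n * `|u - v| <= B + B.
    elim: n u v => [|n IH] u v Eu Ev.
      by rewrite expr0 mul1r (le_trans (ler_normB _ _))// lerD ?EB.
    have := IH _ _ (forward_orbit_stable i0 Eu) (forward_orbit_stable i0 Ev).
    rewrite /f /affine_map opprD addrACA subrr addr0 -mulrBr normrM.
    by rewrite mulrA -exprSr.
  have [n] := unbounded_expr ((B + B + 1) / `|x - y|) (r_gt1 i0).
  rewrite ler_pdivrMr ?normr_gt0// => /le_trans/(_ (H n _ _ Ex Ey)).
  by rewrite gerDl ler10.
exists (f i0 a) => i.
by apply: E1; [apply: forward_orbit_stable|]; exact: forward_orbit_gen.
Qed.

(** The part of [f i @` E] in an interval of radius [h] is a copy of the part of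
    [E] in an interval of radius [h / |r i|]. *)
Lemma counting_piece i x h :
  counting ((f i @` E) `&` `[x - h, x + h]) =
  num_points E ((x - b i) / r i) (h / `|r i|).
Proof.
have fi_inj : injective (f i) by exact/affine_map_inj/slope_neq0.
rewrite /num_points -[RHS](counting_image _ fi_inj).
have mem z : (x - h <= f i z <= x + h) = ((x - b i) / r i - h / `|r i| <= z <=
    (x - b i) / r i + h / `|r i|).
  rewrite -!ler_distl ler_pdivlMr ?slope_gt0// mulrC -normrM.
  congr (`|_| <= _); rewrite /f /affine_map mulrBr mulrCA divff ?slope_neq0//.
  by rewrite mulr1 opprB addrA addrAC.
congr counting; apply/seteqP; split => y /=.
  move=> [[z Ez <-]]; rewrite in_itv /= mem => zI.
  by exists z => //; split=> //; rewrite /= in_itv.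
move=> [z [Ez]]; rewrite /= in_itv /= -mem => zI <-.
by split; [exists z|rewrite in_itv].
Qed.

Lemma num_points_rec_le x h :
  (num_points E x h <=
   \sum_(i < m) num_points E ((x - b i) / r i) (h / `|r i|) + m%:R%:E)%E.
Proof.
under eq_bigr do rewrite -counting_piece.
apply: (counting_cover_le (p := fun i => f i a)) => z [Ez zI].
have [i [->|[y Ey zy]]] := forward_orbit_cases Ez; exists i; first by left.
by right; split=> //; exists y.
Qed.

Lemma num_points_rec_ge : finite_overlaps f a -> exists2 K : R, 0 <= K &
  forall x h,
  (\sum_(i < m) num_points E ((x - b i) / r i)%R (h / `|r i|)%R <=
   num_points E x h + K%:E)%E.
Proof.
move=> ov; pose W (ij : 'I_m * 'I_m) := if ij.1 == ij.2 then set0 else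
  (f ij.1 @` E) `&` (f ij.2 @` E).
pose Z := \bigcup_ij W ij.
have fZ : finite_set Z.
  apply: bigcup_finite; first exact: finite_finset.
  by move=> [i j] _; rewrite /W /=; case: eqVneq => // /eqP ij; exact: ov.
exists (\sum_(i < m) (#|` fset_set Z |)%:R) => [|x h]; first exact: sumr_ge0.
under eq_bigr do rewrite -counting_piece.
rewrite -sumEFin; under [X in (_ + X)%E]eq_bigr do rewrite -counting_fset//.
apply: sum_counting_overlap_le => [i z [[y Ey <-] ?]|i j ij z [[fz ?] [gz ?]]].
  by split=> //; exact: forward_orbit_stable.
by exists (i, j) => //; rewrite /W /= (negbTE ij).
Qed.

(** The margin [d] that absorbs the translations [b i]. *)
Lemma shift_exists (q : R) : 1 < q -> (forall i, q <= `|r i|) ->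
  exists2 d, 0 <= d & forall i, `|b i| + d <= d * `|r i|.
Proof.
move=> q1 qr; have q0 : 0 < q - 1 by rewrite subr_gt0.
have B0 : 0 <= \sum_(i < m) `|b i| by rewrite sumr_ge0.
exists ((\sum_(i < m) `|b i|) / (q - 1)); first by rewrite divr_ge0// ltW.
move=> i; rewrite -lerBrDr -[X in _ * _ - X]mulr1 -mulrBr mulrAC.
rewrite ler_pdivlMr// ler_pM// ?(ltW q0) ?lerB//.
by rewrite (bigD1 i)//= lerDl sumr_ge0.
Qed.

Variable s : R.
Hypothesis s_eq : \sum_(i < m) `|r i| `^ (- s) = 1.
Hypothesis nondeg : ~ degenerate f.

Let m_gt1 : (1 < m)%N := nondegenerate_gt1 nondeg.

Lemma center_shift i d h : `|b i| + d <= d * `|r i| ->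
  `|(0 - b i) / r i - 0| + (h + d) / `|r i| <= h / `|r i| + d.
Proof.
move=> di; rewrite sub0r subr0 normrM normrN normfV -mulrDl.
by rewrite ler_pdivrMr ?slope_gt0// mulrDl divfK ?gt_eqF ?slope_gt0//; lra.
Qed.

Lemma orbit_upper : locally_finite E -> exists2 C, 0 < C &
  forall h, 1 <= h -> (num_points E 0 h <= (C * h `^ s)%:E)%E.
Proof.
move=> lE; have [q [L [q1 _ qL]]] := ratio_bounds r_gt1 m_gt1.
have [i|d d0 dr] := shift_exists q1; first by have /andP[] := qL i.
have homoN : {homo num_points E 0 : x y / x <= y >-> (x <= y)%E}.
  by move=> x y xy; apply: le_num_points; rewrite subrr normr0 add0r.
(* The enlarged count absorbs the shift of the centres. *)
pose M h := num_points E 0 (h + d).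
have [||h h1|C C0 MC] := recursion_upper (M := M) r_gt1 m_gt1 s_eq (ler0n R m).
- by move=> x y xy; apply: homoN; rewrite lerD2r.
- exact: locally_finite_num_points.
- apply: le_trans (num_points_rec_le _ _) _; apply: leeD => //.
  by apply: lee_sum => i _; apply: le_num_points; exact: center_shift.
exists C => // h h1; apply: le_trans (MC h h1).
by apply: homoN; rewrite lerDl.
Qed.

Lemma orbit_lower : finite_overlaps f a -> exists c u, 0 < c /\
  forall h, u <= h -> ((c * h `^ s)%:E <= num_points E 0 h)%E.
Proof.
move=> ov; have [q [L [q1 _ qL]]] := ratio_bounds r_gt1 m_gt1.
have [i|d d0 dr] := shift_exists q1; first by have /andP[] := qL i.
have homoN : {homo num_points E 0 : x y / x <= y >-> (x <= y)%E}.
  by move=> x y xy; apply: le_num_points; rewrite subrr normr0 add0r.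
have [K K0 recK] := num_points_rec_ge ov.
have iE := nondegenerate_orbit_infinite nondeg.
have [B B0 NB] := infinite_num_points (K + 1) iE.
(* The reduced count absorbs the shift of the centres. *)
pose M h := num_points E 0 (h - d).
have [|||h h1|c c0 Mc] := recursion_lower (M := M) (u := B + d)
  r_gt1 m_gt1 s_eq K0.
- by rewrite ltr_wpDr.
- by move=> x y xy; apply: homoN; rewrite lerD2r.
- by rewrite /M addrK.
- apply: le_trans (recK _ _); apply: lee_sum => i _; apply: le_num_points.
  rewrite distrC; have := center_shift (h - d) (dr i).
  by rewrite subrK; lra.
exists c, (B + d); split=> // h uh; apply: le_trans (Mc h uh) _.
by apply: homoN; rewrite gerBl.
Qed.

Lemma sup_num_points_upper : uniformly_locally_finite E -> exists2 C, 0 < C &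
  forall h, 1 <= h -> (sup_num_points E h <= (C * h `^ s)%:E)%E.
Proof.
move=> uE.
apply: (recursion_upper r_gt1 m_gt1 s_eq (ler0n R m)) => [||h h1].
- exact: homo_sup_num_points.
- exact: uE.
apply: ge_ereal_sup => _ [x _ <-]; apply: le_trans (num_points_rec_le _ _) _.
apply: leeD => //; apply: lee_sum => i _.
by apply: ereal_sup_ubound; exists ((x - b i) / r i).
Qed.

(** * Growth of the semigroup *)

Lemma semigroup_affine g : map_semigroup f g ->
  exists c d, g = affine_map c d /\ 1 < `|c|.
Proof.
elim=> [i|{}g h _ [c [d [-> c1]]] _ [c' [d' [-> c'1]]]].
  by exists (r i), (b i).
exists (c * c'), (c * d' + d); split; first exact: affine_map_comp.
by rewrite normrM (lt_trans c1)// ltr_pMr// (lt_trans ltr01).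
Qed.

Lemma slope_le_cases t g : slope_le f t g ->
  exists i, g = f i \/ ((fun h => f i \o h) @` slope_le f (t / `|r i|)) g.
Proof.
move=> [Gg [c [d [gE ct]]]]; have [i [->|[h Gh gh]]] := map_semigroup_cases Gg.
  by exists i; left.
exists i; right; exists h => //; split => //.
have [c' [d' [hE _]]] := semigroup_affine Gh; exists c', d'; split=> //.
move: gh; rewrite gE hE affine_map_comp => /affine_map_eq cE.
by rewrite ler_pdivlMr ?slope_gt0// mulrC -normrM -cE.
Qed.

Lemma slope_le_stable t i :
  (fun h => f i \o h) @` slope_le f (t / `|r i|) `<=` slope_le f t.
Proof.
move=> _ [h [Gh [c [d [hE ct]]]] <-]; split.
  by apply: map_semigroup_comp => //; exact: map_semigroup_gen.
exists (r i * c), (r i * d + b i); rewrite hE affine_map_comp; split=> //.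
by rewrite normrM mulrC -ler_pdivlMr ?slope_gt0.
Qed.

Lemma counting_comp i (A : set (R -> R)) :
  counting ((fun h => f i \o h) @` A) = counting A :> \bar R.
Proof.
apply: counting_image => g h gh; apply/funext => x.
by apply: (affine_map_inj (slope_neq0 i)); exact: (congr1 (@^~ x) gh).
Qed.

(** If [f i \o g = f j \o h], the infinite set [f i (g E)] lies in both
    [f i @` E] and [f j @` E]. *)
Lemma semigroup_branches_disjoint i j g h : finite_overlaps f a ->
  map_semigroup f g -> map_semigroup f h -> f i \o g = f j \o h -> i = j.
Proof.
move=> ov Gg Gh gh; apply: contrapT => ij.
apply: (nondegenerate_orbit_infinite nondeg).
have stable k x : map_semigroup f k -> E x -> E (k x).
  move=> Gk [l Gl <-]; exists (k \o l) => //; exact: map_semigroup_comp.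
have [c [d [gE c1]]] := semigroup_affine Gg.
have inj : injective (f i \o g).
  apply: inj_comp; first exact: affine_map_inj (slope_neq0 i).
  by rewrite gE; apply: affine_map_inj; rewrite -normr_gt0 (lt_trans ltr01).
have sub : E `<=` (f i \o g) @^-1` ((f i @` E) `&` (f j @` E)).
  move=> x Ex; split; first by exists (g x) => //; exact: stable.
  by exists (h x); [exact: stable|rewrite -[RHS]/((f i \o g) x) gh].
by apply: sub_finite_set sub _; apply: finite_preimage (ov _ _ ij); exact: in2W.
Qed.

Lemma homo_counting_slope_le :
  {homo (fun t => counting (slope_le f t) : \bar R) :
    x y / x <= y >-> (x <= y)%E}.
Proof.
move=> x y xy; apply: le_counting => g [Gg [c [d [gE cx]]]].
by split => //; exists c, d; split => //; exact: le_trans xy.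
Qed.

Lemma slope_le_upper : exists2 C, 0 < C &
  forall t, 1 <= t -> (counting (slope_le f t) <= (C * t `^ s)%:E)%E.
Proof.
apply: (recursion_upper r_gt1 m_gt1 s_eq (ler0n R m)) => [||t t1].
- exact: homo_counting_slope_le.
- (* All slopes exceed [1]. *)
  rewrite (_ : slope_le f 1 = set0) ?counting_fset ?ltry//.
  apply/seteqP; split=> // g [Gg [c [d [gE c1]]]].
  have [c' [d' []]] := semigroup_affine Gg.
  by rewrite gE => /affine_map_eq <-; rewrite ltNge c1.
under eq_bigr => i _ do rewrite -(counting_comp i).
by apply: (counting_cover_le (p := f)) => g /slope_le_cases.
Qed.

Lemma slope_le_lower : finite_overlaps f a -> exists c u, 0 < c /\
  forall t, u <= t -> ((c * t `^ s)%:E <= counting (slope_le f t))%E.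
Proof.
move=> ov; pose i0 : 'I_m := Ordinal m_gt1.
have [|||t t1|c c0 Mc] := recursion_lower
  (M := fun t => counting (slope_le f t)) (u := `|r i0|)
  r_gt1 m_gt1 s_eq (lexx 0).
- exact: slope_gt0.
- exact: homo_counting_slope_le.
- rewrite add0r; apply: (@le_trans _ _ (counting [set f i0])).
    by rewrite counting_fset// fset_set1 cardfs1.
  apply: le_counting => _ ->; split; first exact: map_semigroup_gen.
  by exists (r i0), (b i0).
- rewrite adde0.
  under eq_bigr => i _ do rewrite -(counting_comp i).
  apply: sum_counting_le => [i|i j ij]; first exact: slope_le_stable.
  apply/seteqP; split => // _ [[g [Gg _] <-] [h [Gh _] /esym gh]].
  by move/eqP: ij; apply; exact: semigroup_branches_disjoint gh.
by exists c, `|r i0|.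
Qed.

End affine_system.

Unset Implicit Arguments.

Theorem theorem4p16 (R : realType) (m : nat) (r b : 'I_m -> R) (a s : R)
    (r_gt1 : forall i, 1 < `|r i|)
    (f_inj : injective (fun i => affine_map (r i) (b i)))
    (f_nondeg : ~ degenerate (fun i => affine_map (r i) (b i)))
    (s_eq : \sum_(i < m) `|r i| `^ (- s) = 1) :
  let f := fun i => affine_map (r i) (b i) in
  let E := forward_orbit f a in
  (locally_finite E -> finite_overlaps f a ->
    (exists C1 : R, 1 < C1 /\ \forall h \near +oo%R,
      ((C1^-1 * h `^ s)%:E <= num_points E 0 h /\
       num_points E 0 h <= (C1 * h `^ s)%:E)%E) /\
    is_growth_dim f s%:E /\ is_mass_dim E s%:E) /\
  (uniformly_locally_finite E -> finite_overlaps f a ->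
    (exists C2 : R, 1 < C2 /\ \forall h \near +oo%R,
      ((C2^-1 * h `^ s)%:E <= sup_num_points E h /\
       sup_num_points E h <= (C2 * h `^ s)%:E)%E) /\
    is_growth_dim f s%:E /\ is_mass_dim E s%:E /\
    beurling_dim E = s%:E /\ s <= 1).
Proof.
move=> f E.
have nearI (P : R -> Prop) u :
    (forall h, u <= h -> P h) -> \forall h \near +oo%R, P h.
  by move=> uP; exists u; split=> [|h /ltW/uP//]; exact: num_real.
have local_part : locally_finite E -> finite_overlaps f a ->
    [/\ exists2 c, 0 < c & \forall h \near +oo%R,
          ((c * h `^ s)%:E <= num_points E 0 h)%E,
        exists2 C, 0 < C & \forall h \near +oo%R,
          (num_points E 0 h <= (C * h `^ s)%:E)%E,
        is_growth_dim f s%:E & is_mass_dim E s%:E].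
  move=> lE ov.
  have [C C0 /nearI EC] := orbit_upper r_gt1 s_eq f_nondeg lE.
  have [c [u [c0 /nearI Ec]]] := orbit_lower r_gt1 s_eq f_nondeg ov.
  have [C' C'0 /nearI GC] := slope_le_upper r_gt1 s_eq f_nondeg.
  have [c' [u' [c'0 /nearI Gc]]] := slope_le_lower r_gt1 s_eq f_nondeg ov.
  split; [by exists c|by exists C| |].
    apply: (log_ratio_cvg c'0 C'0); near=> t.
    by apply/andP; split; near: t.
  apply: (mass_dim_eq c0 C0); near=> t.
  by apply/andP; split; near: t.
split=> [lE ov|uE ov].
  have [[c c0 Ec] [C C0 EC] dF dM] := local_part lE ov.
  by split; [exact: common_constant Ec EC|].
have [[c c0 Ec] _ dF dM] := local_part (uniformly_locally_finiteW uE) ov.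
have [C C0 /nearI EC] := sup_num_points_upper r_gt1 s_eq f_nondeg uE.
have [D D0 /nearI ED] := sup_num_points_linear uE.
have Esup : \forall h \near +oo%R, ((c * h `^ s)%:E <= sup_num_points E h)%E.
  apply: filterS Ec => h /le_trans; apply.
  by apply: ereal_sup_ubound; exists 0.
split; first exact: common_constant Esup EC.
split=> //; split=> //; split; first exact: beurling_dim_eq Ec EC.
exact: le_exponent Esup ED.
Unshelve. all: by end_near. Qed.
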